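(* Let $A\in\mathbb{R}^{N\times N}$ be symmetric and $B\in\{0,1\}^{N\times M}$, and consider the network $\dot x=Ax+Bu$ with state $x\in\mathcal{X}=\mathbb{R}^N$ and input $u\in\mathbb{R}^M$. Let $\mathcal{C}_1,\dots,\mathcal{C}_K$ be the orbits (clusters) of $\mathrm{aut}(\mathcal{G}(A,B))$ on the node set $\{1,\dots,N\}$. If there exists a permutation matrix $P\neq I$ such that $PA-AP=0$ and $PB-B=0$, then: (i) the set of states $\mathcal{X}_{or}:=\{x:\ x_i=x_l\ \ \forall\, i,l\in\mathcal{C}_j,\ \forall j\}\subset\mathcal{X}$ is an invariant subspace of the matrix $A$, i.e., $\forall x\in\mathcal{X}_{or}$, $Ax\in\mathcal{X}_{or}$; (ii) if $x_i=x_l$ then $\dot x_i=\dot x_l$ for all $(i,l)\in\mathcal{C}_j$ and for all $j$.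
   Context: $\mathrm{aut}(\mathcal{G}(A,B))$ is the group of $N\times N$ permutation matrices $P$ with $PA=AP$ and $PB=B$, acting on the node set $\{1,\dots,N\}$ of the network. Its orbits $\mathcal{C}_1,\dots,\mathcal{C}_K$ are called clusters and form a partition of the nodes. $x_i$ is the state of node $i$; the matrix $A$ defines the network topology; $B_{ij}=1$ if the $j$-th input is injected in node $i$, and $B_{ij}=0$ otherwise. The notation $(i,l)\in\mathcal{C}_j$ means that nodes $i$ and $l$ both belong to the cluster $\mathcal{C}_j$. *)

(* Defs.v *)
From mathcomp Require Import all_boot all_order all_algebra all_fingroup.
From mathcomp Require Import all_classical all_reals all_analysis.

Set Implicit Arguments.
Unset Strict Implicit.
Unset Printing Implicit Defensive.

Import GRing.Theory numFieldNormedType.Exports.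
Local Open Scope ring_scope.

(** A permutation matrix is encoded by its permutation [s], via [perm_mx];
    since [perm_mxM] holds, this is an isomorphism of groups. Note that
    [perm_mx s] sends a column vector [x] to the vector with entries
    [x (s i) 0], so [perm_mx s] moves the basis vector of node [i] to that of
    node [s^-1 i]; the orbits of the group are the same for either convention. *)
Definition net_aut (R : realType) (N M : nat) (A : 'M[R]_N) (B : 'M[R]_(N, M)) :
    {set 'S_N} :=
  [set s : 'S_N | (perm_mx s *m A == A *m perm_mx s) && (perm_mx s *m B == B)].

Lemma group_set_net_aut (R : realType) (N M : nat) (A : 'M[R]_N)
  (B : 'M[R]_(N, M)) : group_set (net_aut A B).
Proof.
apply/group_setP; split=> [|s t].
  by rewrite inE perm_mx1 !mul1mx mulmx1 !eqxx.
rewrite !inE => /andP[/eqP sA /eqP sB] /andP[/eqP tA /eqP tB].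
by rewrite perm_mxM -!mulmxA tA tB sB mulmxA sA -mulmxA !eqxx.
Qed.

Canonical net_aut_group (R : realType) (N M : nat) (A : 'M[R]_N)
  (B : 'M[R]_(N, M)) : {group 'S_N} := Group (group_set_net_aut A B).

Definition clusters (R : realType) (N M : nat) (A : 'M[R]_N)
    (B : 'M[R]_(N, M)) : {set {set 'I_N}} :=
  [set orbit 'P%act (net_aut A B) i | i : 'I_N].

Definition X_or (R : realType) (N M : nat) (A : 'M[R]_N)
    (B : 'M[R]_(N, M)) : {pred 'cV[R]_N} :=
  [pred x : 'cV[R]_N | [forall C in clusters A B,
     forall i in C, forall l in C, x i 0 == x l 0]].

(** The equation is required only at the time [t], so that no regularity of
    the input and no particular interval of existence is assumed. *)
Definition network_eq (R : realType) (N M : nat) (A : 'M[R]_N)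
    (B : 'M[R]_(N, M)) (x : R -> 'cV[R]_N) (u : R -> 'cV[R]_M) (t : R) : Prop :=
  forall i : 'I_N,
    is_derive t 1 (fun s => x s i 0) ((A *m x t + B *m u t) i 0).

(* Main.v *)
Require Import Defs.
From mathcomp Require Import all_boot all_order all_algebra all_fingroup.
From mathcomp Require Import all_classical all_reals all_analysis.

(** The whole statement rests on one reformulation: a state is constant on the
    clusters exactly when it is fixed by every permutation matrix of the group
    ([X_orP]).  The synchronous states are thus the common fixed space of a
    family of linear maps, hence a subspace; and since [A] commutes with each
    of these maps while the columns of [B] are fixed by them, [A *m x] is
    synchronous whenever [x] is and [B *m u] is so for an arbitrary input [u].  The
    right-hand side of the network equation is then synchronous, which says
    that the nodes of one cluster have the same velocity. *)

Set Implicit Arguments.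
Unset Strict Implicit.
Unset Printing Implicit Defensive.

Import GRing.Theory numFieldNormedType.Exports.
Local Open Scope ring_scope.

Section SynchronousStates.

Variables (R : realType) (N M : nat) (A : 'M[R]_N) (B : 'M[R]_(N, M)).

Lemma net_autP (s : 'S_N) :
  reflect (perm_mx s *m A = A *m perm_mx s /\ perm_mx s *m B = B)
          (s \in net_aut A B).
Proof. by rewrite inE; apply: (iffP andP) => -[/eqP ? /eqP ?]. Qed.

Lemma clusters_net_aut (C : {set 'I_N}) (i l : 'I_N) :
  C \in clusters A B -> i \in C -> l \in C ->
  exists2 s, s \in net_aut A B & s i = l.
Proof.
move=> /imsetP[k _ ->] ik lk.
have /orbitP[s sG sil] : l \in orbit 'P%act (net_aut_group A B) i.
  by apply: orbit_trans lk _; rewrite orbit_sym.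
by exists s.
Qed.

Lemma X_or_clusters (x : 'cV[R]_N) :
  x \in X_or A B <->
  (forall C, C \in clusters A B ->
     forall i l, i \in C -> l \in C -> x i 0 = x l 0).
Proof.
rewrite inE; split=> [/forall_inP xC C CC i l iC lC|xC].
  by have /forall_inP/(_ i iC)/forall_inP/(_ l lC)/eqP := xC C CC.
apply/forall_inP => C CC; apply/forall_inP => i iC.
by apply/forall_inP => l lC; apply/eqP; exact: (xC C).
Qed.

(** Multiplying by [perm_mx s] moves the entry of node [s i] to node [i], so
    being fixed by all of these matrices is being constant along orbits. *)
Lemma X_orP (x : 'cV[R]_N) :
  x \in X_or A B <-> (forall s, s \in net_aut A B -> perm_mx s *m x = x).
Proof.
rewrite X_or_clusters; split=> [xC s sG|xfix C CC i l iC lC].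
  apply/colP => i; rewrite -row_permE mxE.
  apply: (xC (orbit 'P%act (net_aut A B) i)); first exact: imset_f.
    exact: (mem_orbit 'P%act i sG).
  exact: (orbit_refl 'P%act (net_aut_group A B)).
have [s sG <-] := clusters_net_aut CC iC lC.
by rewrite -{1}(xfix s sG) -row_permE mxE.
Qed.

Lemma X_or_submod : GRing.submod_closed (X_or A B).
Proof.
split=> [|a x y /X_orP xfix /X_orP yfix]; apply/X_orP => s sG.
  by rewrite mulmx0.
by rewrite mulmxDr -scalemxAr xfix // yfix.
Qed.

Lemma X_or_mulmx (x : 'cV[R]_N) : x \in X_or A B -> A *m x \in X_or A B.
Proof.
move=> /X_orP xfix; apply/X_orP => s sG.
by have /net_autP[sA _] := sG; rewrite mulmxA sA -mulmxA xfix.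
Qed.

(** The columns of [B] are constant on each cluster, so every input acts in
    the same way on all the nodes of a cluster and cannot desynchronise it. *)
Lemma X_or_input (u : 'cV[R]_M) : B *m u \in X_or A B.
Proof. by apply/X_orP => s /net_autP[_ sB]; rewrite mulmxA sB. Qed.

Lemma X_or_velocity (x : 'cV[R]_N) (u : 'cV[R]_M) :
  x \in X_or A B -> A *m x + B *m u \in X_or A B.
Proof.
move=> /X_or_mulmx AxX; rewrite -[A *m x]scale1r.
by apply: (X_or_submod.2 1 (A *m x)) => //; exact: X_or_input.
Qed.

End SynchronousStates.

Theorem theorem1 (R : realType) (N M : nat) (A : 'M[R]_N) (B : 'M[R]_(N, M))
  (A_sym : A^T = A)
  (B_01 : forall i j, B i j = 0 \/ B i j = 1)
  (P_ex : exists P : 'M[R]_N, [/\ is_perm_mx P, P <> 1%:M,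
            P *m A - A *m P = 0 & P *m B - B = 0]) :
  (GRing.submod_closed (X_or A B) /\
   (forall x : 'cV[R]_N, x \in X_or A B -> A *m x \in X_or A B)) /\
  (forall (x : R -> 'cV[R]_N) (u : R -> 'cV[R]_M) (t : R),
     network_eq A B x u t ->
     (forall C, C \in clusters A B ->
        forall i l, i \in C -> l \in C -> x t i 0 = x t l 0) ->
     forall C, C \in clusters A B ->
       forall i l, i \in C -> l \in C ->
         derive1 (fun s => x s i 0) t = derive1 (fun s => x s l 0) t).
Proof.
split; first by split; [exact: X_or_submod | exact: X_or_mulmx].
move=> x u t xeq /X_or_clusters xX C CC i l iC lC.
have /X_or_clusters vX := X_or_velocity (u t) xX.
have velocity k :
    derive1 (fun s => x s k 0) t = (A *m x t + B *m u t) k 0.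
  by rewrite derive1E; have [_ ->] := xeq k.
by rewrite !velocity; exact: (vX C).
Qed.
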